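(* Let $G$ be a connected graph that is the gated amalgam of two smooth graphs $G_1$ and $G_2$. Then $G$ is a smooth graph.
   Context: Graphs are simple and undirected; $d$ denotes the shortest path distance of a connected graph $G$. Intervals: $I[u,v]=\{w\in V(G): d(u,w)+d(w,v)=d(u,v)\}$; $N(u)=\{w: d(u,w)=1\}$; the step system (step function) of $G$ is $S(u,v)=I[u,v]\cap N(u)$. A connected graph $G$ is smooth if for all vertices $u,v,w,x,y$: $v\in S(u,w)$, $v\in S(u,y)$ and $x\in S(w,y)$ imply $v\in S(u,x)$. A subset $W\subseteq V(G)$ is gated if for every vertex $u$ of $G$ there exists a vertex $u_W\in W$ (the gate of $u$) such that $u_W$ lies on all shortest $u,v$-paths for all $v\in W$. A graph $G$ is the gated amalgam of $G_1$ and $G_2$ if $G$ contains two gated sets $W_1,W_2\subset V(G)$ such that $W_1\cap W_2\neq\emptyset$, $W_1\cup W_2=V(G)$, $G_1\simeq G[W_1]$ and $G_2\simeq G[W_2]$, where $G[W]$ denotes the subgraph induced by $W$. *)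

(* Defs.v *)
From mathcomp Require Import all_boot.
From mathcomp Require Import boolp classical_sets.

Set Implicit Arguments.
Unset Strict Implicit.
Unset Printing Implicit Defensive.

Local Open Scope classical_set_scope.

(* The vertex set may be infinite. *)
Record sgraph := SGraph {
  vertex :> eqType;
  adj : rel vertex;
  adj_sym : symmetric adj;
  adj_irr : irreflexive adj }.

Section Distance.
Variable G : sgraph.
Implicit Types (u v w : G) (p : seq G) (W : set G).

(* The path is u :: p. *)
Definition uv_path u v p : bool :=
  [&& path (@adj G) u p, last u p == v & uniq (u :: p)].

(* The empty graph is connected here; a gated amalgam is never empty. *)
Definition connected : Prop := forall u v, exists p, uv_path u v p.

(* The default value 0 is only taken when no path joins u to v. *)
Definition dist u v : nat :=
  xget 0 [set n | (exists2 p, uv_path u v p & size p = n) /\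
                  (forall p, uv_path u v p -> n <= size p)].

Definition shortest_path u v p : Prop := uv_path u v p /\ size p = dist u v.

Definition interval u v : set G := [set w | dist u w + dist w v = dist u v].

Definition nbr u : set G := [set w | dist u w = 1].

Definition step u v : set G := interval u v `&` nbr u.

Definition smooth : Prop :=
  connected /\
  forall u v w x y, step u w v -> step u y v -> step w y x -> step u x v.

Definition gated W : Prop :=
  forall u, exists2 g, W g &
    forall v, W v -> forall p, shortest_path u v p -> g \in u :: p.

Definition induced_adj W : rel (set_type W) :=
  fun x y => adj (val x) (val y).

Lemma induced_sym W : symmetric (@induced_adj W).
Proof. by move=> x y; apply: adj_sym. Qed.

Lemma induced_irr W : irreflexive (@induced_adj W).
Proof. by move=> x; apply: adj_irr. Qed.

Definition induced W : sgraph := SGraph (@induced_sym W) (@induced_irr W).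

End Distance.

Definition isomorphic (G H : sgraph) : Prop :=
  exists2 f : G -> H, bijective f & forall x y, adj (f x) (f y) = adj x y.

Definition gated_amalgam (G G1 G2 : sgraph) : Prop :=
  exists W1 W2 : set G,
    [/\ gated W1 /\ gated W2,
        W1 `&` W2 !=set0,
        W1 `|` W2 = [set: G],
        isomorphic G1 (induced W1)
      & isomorphic G2 (induced W2)].

(* Main.v *)
Require Import Defs.
From mathcomp Require Import all_boot zify.
From mathcomp Require Import boolp classical_sets.

Set Implicit Arguments.
Unset Strict Implicit.
Unset Printing Implicit Defensive.

(** A connected graph is smooth exactly when, for every edge [uv], the set
    [{z | v \in S(u,z)}] of vertices strictly closer to [v] than to [u] is
    convex: the axiom moves membership one step along a geodesic, and an
    induction moves it along the whole geodesic ([step_convex]).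

    Gated sets are convex, and a convex set carries the metric of [G], so the
    smoothness of [G1] and [G2] becomes a property of distances of [G] between
    vertices of [W1], respectively of [W2] ([smooth_on_image]).  Moreover no
    edge joins [W1 \ W2] to [W2 \ W1] ([edge_in_part]).

    Let [v \in S(u,w)], [v \in S(u,y)] and [x \in S(w,y)], where by symmetry the
    edge [uv] lies in [W1].  Write [z'] for the gate of [z] in [W1].  All
    distances from [u] and [v] to [z] exceed the distances to [z'] by the same
    amount, so [v \in S(u,z)] if and only if [v \in S(u,z')].  It therefore
    suffices to apply the smoothness of [W1] to [u, v, w', x', y'], and for this
    the gates must satisfy [x' = w'] or [x' \in S(w',y')].  This is [gate_step],
    the core of the proof.  Its only difficult case has [w], [x] and [y] in
    [W2] and [x'] different from [w']; then [w] and [x] are at the same distance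
    from their gates, so [x'] and [y] are both closer to [x] than to [w].
    Smoothness of [W2] makes that set of vertices convex, hence it contains
    [y'], which lies between [x'] and [y]; and [y'] is closer to [x] than to [w]
    only if it is closer to [x'] than to [w']. *)

(** * The path metric *)

Section Metric.
Variable G : sgraph.
Hypothesis hG : connected G.
Implicit Types (u v w x y z g : G) (p : seq G) (W : set G).

Lemma dist_spec u v :
  (exists2 p, uv_path u v p & size p = dist u v) /\
  (forall p, uv_path u v p -> dist u v <= size p).
Proof.
rewrite /dist; case: xgetP => [n _ //|none]; exfalso.
have [p0 p0P] := hG u v.
pose P n := `[< exists2 p, uv_path u v p & size p = n >].
have exP : exists n, P n by exists (size p0); apply/asboolP; exists p0.
case: (ex_minnP exP) => n /asboolP nP n_min.
apply: (none n); split=> // p pP.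
by apply: n_min; apply/asboolP; exists p.
Qed.

Lemma shortest_path_ex u v : exists p, shortest_path u v p.
Proof. by have [[p pP sp] _] := dist_spec u v; exists p. Qed.

Lemma dist_le_walk u v p :
  path (@adj G) u p -> last u p = v -> dist u v <= size p.
Proof.
move=> pP pl; have [_ dmin] := dist_spec u v.
case: (shortenP pP) pl => q qP uq sub_qp ql.
apply: (@leq_trans (size q)).
  by apply: dmin; rewrite /uv_path qP ql eqxx uq.
by apply: uniq_leq_size => //; case/andP: uq.
Qed.

Lemma dist_eq0 u v : dist u v = 0 -> u = v.
Proof.
have [p [/and3P[_ /eqP pl _] sp]] := shortest_path_ex u v.
by move=> d0; move: sp pl; rewrite d0 => /size0nil ->.
Qed.

Lemma distxx u : dist u u = 0.
Proof. by have := @dist_le_walk u u [::] isT erefl; rewrite leqn0 => /eqP. Qed.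

Lemma dist_triangle u v w : dist u w <= dist u v + dist v w.
Proof.
have [p [/and3P[pP /eqP pl _] <-]] := shortest_path_ex u v.
have [q [/and3P[qP /eqP ql _] <-]] := shortest_path_ex v w.
rewrite -size_cat; apply: dist_le_walk.
  by rewrite cat_path pP pl qP.
by rewrite last_cat pl.
Qed.

Lemma dist_sym u v : dist u v = dist v u.
Proof.
suff le_d (a b : G) : dist a b <= dist b a by apply/eqP; rewrite eqn_leq !le_d.
have [p [/and3P[pP /eqP pl _] <-]] := shortest_path_ex b a.
rewrite -(size_belast b p) -(size_rev (belast b p)).
apply: dist_le_walk; last first.
  by rewrite -pl; case: (p) => //= c q; rewrite rev_cons last_rcons.
rewrite -pl rev_path; apply: sub_path pP => c d.
by rewrite adj_sym.
Qed.

Lemma dist_adj u v : adj u v -> dist u v = 1.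
Proof.
move=> uv; have : dist u v <= 1.
  by apply: (@dist_le_walk u v [:: v]) => //=; rewrite uv.
rewrite leq_eqVlt => /orP[/eqP //|]; rewrite ltnS leqn0 => /eqP/dist_eq0 uv'.
by rewrite uv' adj_irr in uv.
Qed.

Lemma dist_succ u v n :
  dist u v = n.+1 -> exists x, adj u x /\ dist x v = n.
Proof.
have [[|x p] [/and3P[pP pl _] sp]] := shortest_path_ex u v.
  by rewrite -sp.
move: pP pl sp => /= /andP[ux pP] /eqP pl sp d; exists x; split=> //.
have := dist_le_walk pP pl; have := dist_triangle u x v.
rewrite (dist_adj ux); lia.
Qed.

Lemma stepP u w v :
  step u w v <-> dist u v = 1 /\ (dist v w).+1 = dist u w.
Proof.
rewrite /step /interval /nbr /=; split.
  by case=> /= h1 h2; split=> //; lia.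
by case=> h1 h2; split=> /=; lia.
Qed.

(** * Gates and convexity *)

Definition convex W : Prop :=
  forall a b z, W a -> W b -> interval a b z -> W z.

Definition is_gate W u g : Prop :=
  W g /\ forall v, W v -> dist u g + dist g v = dist u v.

Lemma gate_ex W u : gated W -> exists g, is_gate W u g.
Proof.
move=> /(_ u)[g Wg gP]; exists g; split=> // v Wv.
have [p spP] := shortest_path_ex u v.
have gp := gP v Wv p spP.
case: spP => /and3P[pP /eqP pl _] sp.
have := dist_triangle u g v; rewrite -sp.
case/splitPl: gp pP pl => p1 p2 p1l; rewrite cat_path last_cat p1l.
case/andP=> p1P p2P p2l; rewrite size_cat.
have := dist_le_walk p1P p1l; have := dist_le_walk p2P p2l; lia.
Qed.

(** If [z] lies between two vertices of [W], going through the gate of [z] in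
    both directions costs twice the distance from [z] to its gate. *)
Lemma gated_convex W : gated W -> convex W.
Proof.
move=> gW a b z Wa Wb; rewrite /interval /= => zab.
have [g [Wg gP]] := gate_ex z gW.
suff /dist_eq0 -> : dist z g = 0 by [].
have := gP a Wa; have := gP b Wb; have := dist_triangle a g b.
rewrite (dist_sym a z) in zab; rewrite (dist_sym a g); lia.
Qed.

Lemma step_gate W u v z g :
  is_gate W z g -> W u -> W v -> step u z v <-> step u g v.
Proof.
case=> _ gP Wu Wv; have := gP u Wu; have := gP v Wv.
rewrite (dist_sym g) (dist_sym z v) (dist_sym g) (dist_sym z u) => hv hu.
by split=> /stepP[uv d]; apply/stepP; split=> //; lia.
Qed.

(** Smoothness of the subgraph induced by [W], read off in the metric of [G];
    this is adequate only when [W] is isometric in [G], as convex sets are. *)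
Definition smooth_on W : Prop :=
  forall u v w x y, W u -> W v -> W w -> W x -> W y ->
    step u w v -> step u y v -> step w y x -> step u x v.

(** Iterating the smoothness axiom along a geodesic from [w] through [z]. *)
Lemma step_convex W u v w y z :
  convex W -> smooth_on W -> W u -> W v -> W w -> W y ->
  step u w v -> step u y v -> interval w y z -> step u z v.
Proof.
move=> cW sW Wu Wv Ww Wy uw uy; rewrite /interval /= => wzy.
have [n wz] : exists n, dist w z = n by eexists.
elim: n w Ww uw wzy wz => [|n IHn] w Ww uw wzy wz.
  by rewrite -(dist_eq0 wz).
have [x [wx xz]] := dist_succ wz.
have {}wx := dist_adj wx.
have xy : (dist x y).+1 = dist w y.
  have := dist_triangle x z y; have := dist_triangle w x y; lia.
have wyx : step w y x by apply/stepP.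
have Wx : W x by apply: (cW w y) => //; case: wyx.
apply: (IHn x) => //; last lia.
exact: (sW _ _ w _ y).
Qed.

(** * The two parts of a gated amalgam *)

Section Amalgam.
Variables W1 W2 : set G.
Hypotheses (gW1 : gated W1) (gW2 : gated W2).
Hypothesis W12 : exists c, W1 c /\ W2 c.
Hypothesis cover : forall z, W1 z \/ W2 z.

(** Were [a] in [W1] only and [b] in [W2] only, each would be the gate of the
    other, and each would be closer than the other to a common vertex. *)
Lemma edge_in_part a b : dist a b = 1 -> (W1 a /\ W1 b) \/ (W2 a /\ W2 b).
Proof.
move=> ab; have [c [W1c W2c]] := W12.
have opposite (V : set G) u v : gated V -> V c -> V v -> dist u v = 1 -> ~ V u ->
    dist u c = (dist v c).+1.
  move=> gV Vc Vv uv nVu; have [g [Vg gP]] := gate_ex u gV.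
  have := gP v Vv; have := gP c Vc.
  case E: (dist u g) => [|n]; first by rewrite (dist_eq0 E) in nVu.
  move=> uc h; have /dist_eq0 gv : dist g v = 0 by lia.
  rewrite gv in uc E; lia.
have [a1|n1a] := pselect (W1 a); have [b1|n1b] := pselect (W1 b).
- by left.
- have b2 : W2 b by case: (cover b).
  have [a2|n2a] := pselect (W2 a); first by right.
  have := opposite _ _ _ gW2 W2c b2 ab n2a.
  by have := opposite _ _ _ gW1 W1c a1 (etrans (dist_sym b a) ab) n1b; lia.
- have a2 : W2 a by case: (cover a).
  have [b2|n2b] := pselect (W2 b); first by right.
  have := opposite _ _ _ gW2 W2c a2 (etrans (dist_sym b a) ab) n2b.
  by have := opposite _ _ _ gW1 W1c b1 ab n1a; lia.
- by right; split; [case: (cover a)|case: (cover b)].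
Qed.

Lemma gate_self z g : W1 z -> is_gate W1 z g -> g = z.
Proof.
by move=> W1z [_ /(_ z W1z)]; rewrite distxx => h; rewrite (@dist_eq0 z g) //; lia.
Qed.

(** The gate lies on geodesics from [z] to a common vertex, and [W2] is
    convex. *)
Lemma gate_in_both z g : W2 z -> is_gate W1 z g -> W2 g.
Proof.
move=> W2z [_ gP]; have [c [W1c W2c]] := W12.
exact: (gated_convex gW2 W2z W2c (gP c W1c)).
Qed.

(** Projecting an edge of a geodesic to [W1] either contracts it or keeps it an
    edge of a geodesic.  In the contrary case [y'] would be a vertex between [x']
    and [y] outside the convex set of vertices closer to [x] than to [w]. *)
Lemma gate_step w x y w' x' y' :
  smooth_on W2 ->
  is_gate W1 w w' -> is_gate W1 x x' -> is_gate W1 y y' ->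
  step w y x -> x' = w' \/ step w' y' x'.
Proof.
move=> sW2 gw gx gy st; have /stepP[wx xy] := st.
case: (edge_in_part wx) => -[Ww Wx].
  rewrite (gate_self Ww gw) (gate_self Wx gx); right.
  by apply/(step_gate gy).
have [W1w' wP] := gw; have [W1x' xP] := gx; have [W1y' yP] := gy.
(* These bounds give [dist w' x' <= 1], with equality only if [w] and [x] are
   at the same distance from their gates. *)
have ww'x' := wP x' W1x'; have xx'w' := xP w' W1w'.
have twx := dist_triangle w x x'; have txw := dist_triangle x w w'.
rewrite (dist_sym x' w') in xx'w'; rewrite (dist_sym x w) in txw.
case E: (dist w' x') => [|n]; first by left; rewrite (dist_eq0 E).
have n0 : n = 0 by lia.
have eq_h : dist w w' = dist x x' by lia.
right; case: (cover y) => Wy.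
  rewrite (gate_self Wy gy); apply/stepP.
  by have := wP y Wy; have := xP y Wy; lia.
have W2x' := gate_in_both Wx gx; have W2y' := gate_in_both Wy gy.
have st1 : step w x' x by apply/stepP; lia.
have x'y : interval x' y y'.
  rewrite /interval /= (dist_sym x' y') (dist_sym y' y) (dist_sym x' y).
  by have := yP x' W1x'; lia.
have /stepP[_ h] :=
  step_convex (gated_convex gW2) sW2 Ww Wx W2x' Wy st1 st x'y.
by apply/stepP; have := wP y' W1y'; have := xP y' W1y'; lia.
Qed.

Lemma smooth_at_edge u v w x y :
  smooth_on W1 -> smooth_on W2 -> W1 u -> W1 v ->
  step u w v -> step u y v -> step w y x -> step u x v.
Proof.
move=> sW1 sW2 Wu Wv uw uy wy.
have [w' gw] := gate_ex w gW1; have [x' gx] := gate_ex x gW1.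
have [y' gy] := gate_ex y gW1.
have {}uw : step u w' v by apply/(step_gate gw).
have {}uy : step u y' v by apply/(step_gate gy).
apply/(step_gate gx Wu Wv).
have [->//|w'y'] := gate_step sW2 gw gx gy wy.
by apply: (sW1 _ _ w' _ y') => //; [case: gw|case: gx|case: gy].
Qed.

End Amalgam.
End Metric.

(** * Transfer of smoothness to the parts *)

(** By convexity, a geodesic of [G] between two vertices of the image stays in
    the image, so it lifts to [H] edge by edge. *)
Lemma convex_embedding_isometric (H G : sgraph) (h : H -> G) (W : set G) :
  connected H -> connected G -> convex W -> injective h ->
  (forall x, W (h x)) -> (forall z, W z -> exists x, h x = z) ->
  (forall x y, adj (h x) (h y) = adj x y) ->
  forall x y, dist (h x) (h y) = dist x y.
Proof.
move=> cH cG cW h_inj Wh h_onto h_adj x y; apply/eqP; rewrite eqn_leq.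
apply/andP; split.
  have [p [/and3P[pP /eqP pl _] <-]] := shortest_path_ex cH x y.
  rewrite -(size_map h); apply: (dist_le_walk cG); last by rewrite last_map pl.
  by rewrite path_map; apply: sub_path pP => a b /=; rewrite h_adj.
have [n hxy] : exists n, dist (h x) (h y) = n by eexists.
elim: n x hxy => [|n IHn] x hxy.
  by rewrite (h_inj _ _ (dist_eq0 cG hxy)) (distxx cH).
have [z [xz zy]] := dist_succ cG hxy.
have Wz : W z.
  by apply: (cW (h x) (h y)) => //; rewrite /interval /= (dist_adj cG xz) zy hxy.
have [z' z'E] := h_onto z Wz; rewrite -z'E in xz zy.
have := IHn z' zy; have := dist_triangle cH x z' y.
by rewrite h_adj in xz; rewrite (dist_adj cH xz); lia.
Qed.

Lemma smooth_on_image (H G : sgraph) (W : set G) :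
  connected G -> smooth H -> gated W -> isomorphic H (induced W) ->
  smooth_on W.
Proof.
move=> cG [cH sH] gW [f [g fK gK] f_adj].
pose h (x : H) : G := val (f x).
have Wh x : W (h x) by apply: set_mem; exact: valP (f x).
have h_onto z : W z -> exists x, h x = z.
  by move=> /mem_set Wz; exists (g (Sub z Wz)); rewrite /h gK SubK.
have h_inj : injective h by move=> x y /val_inj /(can_inj fK).
have iso := convex_embedding_isometric cH cG (gated_convex cG gW) h_inj Wh
  h_onto f_adj.
have stepE a b c : step (h a) (h b) (h c) <-> step a b c.
  by rewrite !stepP !iso.
move=> u v w x y /h_onto[u' <-] /h_onto[v' <-] /h_onto[w' <-] /h_onto[x' <-].
by move=> /h_onto[y' <-] /stepE s1 /stepE s2 /stepE s3; apply/stepE/(sH _ _ w' _ y').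
Qed.

Theorem theorem22 (G G1 G2 : sgraph) (hG : connected G)
    (h1 : smooth G1) (h2 : smooth G2) (hA : gated_amalgam G G1 G2) :
  smooth G.
Proof.
split=> // u v w x y uw uy wy.
have [W1 [W2 [[gW1 gW2] [c [W1c W2c]] W12T iso1 iso2]]] := hA.
have sW1 := smooth_on_image hG h1 gW1 iso1.
have sW2 := smooth_on_image hG h2 gW2 iso2.
have cover z : W1 z \/ W2 z by have : setT z by []; rewrite -W12T.
have cover' z : W2 z \/ W1 z by case: (cover z); [right|left].
have W12 : exists c, W1 c /\ W2 c by exists c.
have W21 : exists c, W2 c /\ W1 c by exists c.
have [_ uv] := uw.
case: (edge_in_part hG gW1 gW2 W12 cover uv) => -[Wu Wv].
  exact: (smooth_at_edge hG gW1 gW2 W12 cover sW1 sW2 Wu Wv uw uy wy).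
exact: (smooth_at_edge hG gW2 gW1 W21 cover' sW2 sW1 Wu Wv uw uy wy).
Qed.
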